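(* There is a polynomial $F(y,n,s,x,w,k,l,m,i,j,v_1,v_2,v_3)$ with integer coefficients such that for all natural numbers $y,n,s$ with $n\ge s>0$: $y=\binom{n}{s}$ holds if and only if there exist natural numbers $x,w,k,l,m,i,j,v_1,v_2,v_3$ with $F(y,n,s,x,w,k,l,m,i,j,v_1,v_2,v_3)=0$.
   Context: All variables range over the natural numbers $\{0,1,2,\ldots\}$; $\binom{n}{s}$ denotes the binomial coefficient. *)

(* Defs.v *)
From mathcomp Require Import all_boot all_algebra.
From mathcomp Require Import mpoly.

Set Implicit Arguments.
Unset Strict Implicit.
Unset Printing Implicit Defensive.

(* Main.v *)
(* With U > 2^n, the binomial coefficient 'C(n, s) is the digit of weight U^s of
   (U + 1)^n in base U, that is, floor ((U + 1)^n / U^s) mod U.  Write Y_a(r) for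
   the second component of the r-th solution of x^2 - (a^2 - 1) y^2 = 1; it is
   close to (2a)^(r-1).  For V huge,
     Y_{V(U+1)+1}(n+1) / (Y_{VU+1}(s+1) Y_{V+1}(n-s+1))
   is so close to (U + 1)^n / U^s that both have the same integer part.  An index
   is prescribed modulo a - 1 since Y_a(r) = r mod (a - 1), and being some Y_a(r)
   is a square condition.  Only the largest of the three numbers, C, needs a bound
   on its index, given by the step-down argument of Matiyasevich and Robinson; the
   indices of the other two are bounded because they are at most C.  That U > 2^n
   and V > (2U + 2)^n are again square conditions: the index of a positive
   solution y of the Pell equation in base a with (a - 1) | y is at least a - 1.

   To save unknowns, five of the seven square conditions are made pairwise
   coprime and multiplied together; the product and a further square share one
   unknown, and the last square shares one with the inequality that determines
   the integer part. *)

Require Import Defs.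
From mathcomp Require Import all_boot all_order all_algebra.
From mathcomp Require Import mpoly.
From mathcomp Require Import zify ring.

Set Implicit Arguments.
Unset Strict Implicit.
Unset Printing Implicit Defensive.
Import Order.TTheory GRing.Theory Num.Theory.
Local Open Scope ring_scope.

(** * Solutions of the Pell equation *)

(** The pair (X, Y) with X + Y sqrt(a^2 - 1) = (a + sqrt(a^2 - 1))^k. *)
Fixpoint pell (a : int) (k : nat) : int * int :=
  if k is k'.+1 then
    let p := pell a k' in (a * p.1 + (a ^+ 2 - 1) * p.2, p.1 + a * p.2)
  else (1, 0).

Definition pellX (a : int) k := (pell a k).1.
Definition pellY (a : int) k := (pell a k).2.

Lemma pellXS (a : int) k : pellX a k.+1 =
  a * pellX a k + (a ^+ 2 - 1) * pellY a k.
Proof. by []. Qed.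

Lemma pellYS (a : int) k : pellY a k.+1 = pellX a k + a * pellY a k.
Proof. by []. Qed.

Lemma pellX0 (a : int) : pellX a 0 = 1. Proof. by []. Qed.
Lemma pellY0 (a : int) : pellY a 0 = 0. Proof. by []. Qed.

Lemma pell_eq (a : int) k : pellX a k ^+ 2 = (a ^+ 2 - 1) * pellY a k ^+ 2 + 1.
Proof.
elim: k => [|k IH]; first by rewrite pellX0 pellY0; ring.
rewrite pellXS pellYS.
have -> : (a * pellX a k + (a ^+ 2 - 1) * pellY a k) ^+ 2 =
  (a ^+ 2 - 1) * (pellX a k + a * pellY a k) ^+ 2
  + (pellX a k ^+ 2 - (a ^+ 2 - 1) * pellY a k ^+ 2) by ring.
by rewrite IH; ring.
Qed.

Lemma pellD (a : int) k l :
  (pellX a (k + l) = pellX a k * pellX a l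
                     + (a ^+ 2 - 1) * (pellY a k * pellY a l)) /\
  (pellY a (k + l) = pellX a k * pellY a l + pellY a k * pellX a l).
Proof.
elim: k => [|k [IHX IHY]].
  by rewrite add0n pellX0 pellY0; split; ring.
by rewrite addSn !pellXS !pellYS IHX IHY; split; ring.
Qed.

Lemma pellXD (a : int) k l :
  pellX a (k + l) =
  pellX a k * pellX a l + (a ^+ 2 - 1) * (pellY a k * pellY a l).
Proof. by case: (pellD a k l). Qed.

Lemma pellYD (a : int) k l :
  pellY a (k + l) = pellX a k * pellY a l + pellY a k * pellX a l.
Proof. by case: (pellD a k l). Qed.

Lemma pellYB (a : int) k l : (k <= l)%N ->
  pellY a (l - k) = pellX a k * pellY a l - pellY a k * pellX a l.
Proof.
move=> /subnKC {2 3}<-; rewrite pellYD pellXD.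
set m := (l - k)%N.
transitivity ((pellX a k ^+ 2 - (a ^+ 2 - 1) * pellY a k ^+ 2) * pellY a m).
  by rewrite pell_eq; ring.
by ring.
Qed.

(** The second bound, (a - 1) Y < X, carries the induction. It gives X > 0, and 2 Y < X once a >
    2. *)
Lemma pell_ge (a : int) k : 1 < a
  -> 0 <= pellY a k /\ a * pellY a k < pellX a k + pellY a k.
Proof.
move=> a1; elim: k => [|k [IH0 IH1]]; first by rewrite pellX0 pellY0; lia.
rewrite pellXS pellYS; split; nia.
Qed.

Lemma pellY_ge0 (a : int) k : 1 < a -> 0 <= pellY a k.
Proof. by move=> /(pell_ge k)[]. Qed.

Lemma pellX_gt0 (a : int) k : 1 < a -> 0 < pellX a k.
Proof. by move=> a1; have [] := pell_ge k a1; nia. Qed.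

Lemma pellY_rec (a : int) k : pellY a k.+2 = 2 * a * pellY a k.+1 - pellY a k.
Proof. by rewrite !(pellYS, pellXS); ring. Qed.

Lemma pellY_ltS (a : int) k : 1 < a -> pellY a k < pellY a k.+1.
Proof.
move=> a1; rewrite pellYS; have := pellX_gt0 k a1; have := pellY_ge0 k a1; nia.
Qed.

Lemma pellY_mono (a : int) : 1 < a
  -> {mono pellY a : k l / (k <= l)%N >-> k <= l}.
Proof.
move=> a1; apply: (le_mono (f := pellY a)) => //.
by apply: homo_ltn; [exact: lt_trans | move=> k; exact: pellY_ltS].
Qed.

Lemma pellY_inj (a : int) : 1 < a -> injective (pellY a).
Proof.
by move=> a1 k l e; apply/eqP; rewrite eqn_leq -!(pellY_mono a1) e lexx.
Qed.

Lemma pellY_geid (a : int) k : 1 < a -> k%:Z <= pellY a k.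
Proof.
move=> a1; elim: k => [|k IH]; first by rewrite pellY0.
have := pellY_ltS k a1; lia.
Qed.

Lemma pellY_lb (a : int) k : 1 < a -> (2 * a - 1) ^+ k <= pellY a k.+1.
Proof.
move=> a1; elim: k => [|k IH]; first by rewrite pellYS pellX0 pellY0; lia.
rewrite pellY_rec exprS; have := pellY_ltS k a1.
set z := _ ^+ k in IH *; nia.
Qed.

Lemma pellY_ub (a : int) k : 1 < a -> pellY a k.+1 <= (2 * a) ^+ k.
Proof.
move=> a1; elim: k => [|k IH]; first by rewrite pellYS pellX0 pellY0; lia.
rewrite pellY_rec exprS; have := pellY_ge0 k a1.
set z := _ ^+ k in IH *; nia.
Qed.

(** Modulo a - 1 the recurrence keeps X = 1 and adds 1 to Y at each step. *)
Lemma pellY_id_dvd (a : int) k : (a - 1 %| pellY a k - k%:Z)%Z.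
Proof.
suff [_ //] : (a - 1 %| pellX a k - 1)%Z /\ (a - 1 %| pellY a k - k%:Z)%Z.
elim: k => [|k [/dvdzP[u eu] /dvdzP[v ev]]];
  first by rewrite pellX0 pellY0 !subrr.
rewrite pellXS pellYS; split; apply/dvdzP.
  exists (pellX a k + u + (a + 1) * pellY a k).
  have -> : pellX a k = u * (a - 1) + 1 by lia.
  by ring.
exists (u + v + pellY a k); have -> : pellX a k = u * (a - 1) + 1 by lia.
have -> : k.+1%:Z = k%:Z + 1 by lia.
have -> : k%:Z = pellY a k - v * (a - 1) by lia.
ring.
Qed.

Lemma pellY_base_dvd (m a b : int) k : (m %| b - a)%Z
  -> (m %| pellY b k - pellY a k)%Z.
Proof.
case/dvdzP=> c ec; have -> : b = a + c * m by lia.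
suff [_ //] : (m %| pellX (a + c * m) k - pellX a k)%Z /\
              (m %| pellY (a + c * m) k - pellY a k)%Z.
elim: k => [|k [/dvdzP[u eu] /dvdzP[v ev]]].
  by rewrite !pellX0 !pellY0 !subrr dvdz0.
rewrite !pellXS !pellYS.
have -> : pellX (a + c * m) k = pellX a k + u * m by lia.
have -> : pellY (a + c * m) k = pellY a k + v * m by lia.
set x := pellX a k; set y := pellY a k; split; apply/dvdzP.
  exists (a * u + c * (x + u * m) + (2 * a * c + c ^+ 2 * m) * (y + v * m)
          + (a ^+ 2 - 1) * v); ring.
by exists (u + a * v + c * (y + v * m)); ring.
Qed.

(** Descent on y: multiplying x + y sqrt(a^2 - 1) by a - sqrt(a^2 - 1) gives a solution whose second
    component a y - x lies in [0, y). *)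
Lemma pell_solution (a x y : int) : 1 < a -> 0 <= y ->
  x ^+ 2 = (a ^+ 2 - 1) * y ^+ 2 + 1 -> exists k, y = pellY a k.
Proof.
move=> a1 y0 e.
suff [k [_ ->]] : exists k, `|x| = pellX a k /\ y = pellY a k by exists k.
have {}e : `|x| ^+ 2 = (a ^+ 2 - 1) * y ^+ 2 + 1 by rewrite -e; lia.
move: (`|x|) (normr_ge0 x) e => {}x x0.
have [m] := ubnP `|y|%N; elim: m x y x0 y0 => // m IH x y x0 y0 ym e.
have [yz|y1] := eqVneq y 0.
  by exists 0%N; rewrite pellX0 pellY0; split => //; move: e; rewrite yz; nia.
have y2 : 0 < y by lia.
have h1 : x <= a * y by nia.
have h2 : (a - 1) * y < x by nia.
have h3 : 0 <= a * x - (a ^+ 2 - 1) * y by nia.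
have [||||k [ex ey]] := IH (a * x - (a ^+ 2 - 1) * y) (a * y - x).
- by [].
- lia.
- lia.
- have -> : (a * x - (a ^+ 2 - 1) * y) ^+ 2 =
    (a ^+ 2 - 1) * (a * y - x) ^+ 2 + (x ^+ 2 - (a ^+ 2 - 1) * y ^+ 2) by ring.
  by rewrite e; ring.
by exists k.+1; rewrite pellXS pellYS -ex -ey; split; ring.
Qed.

Lemma pell_coprime (a : int) k : coprimez (pellX a k) (pellY a k).
Proof.
apply/coprimezP; exists (pellX a k, - (a ^+ 2 - 1) * pellY a k) => /=.
transitivity (pellX a k ^+ 2 - (a ^+ 2 - 1) * pellY a k ^+ 2); first by ring.
by rewrite pell_eq; ring.
Qed.

(** Binomial expansion of (X_p + Y_p sqrt(a^2 - 1))^t modulo Y_p^2. At t = 0 the truncated exponent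
    [t.-1] is harmless, since its coefficient vanishes. *)
Lemma pellX_mulS_mod (a : int) p t : exists u v : int,
  pellX a (p * t) = pellX a p ^+ t + u * pellY a p ^+ 2 /\
  pellY a (p * t) = t%:Z * pellX a p ^+ t.-1 * pellY a p + v * pellY a p ^+ 2.
Proof.
elim: t => [|t [u [v [IHX IHY]]]].
  by exists 0, 0; rewrite muln0 pellX0 pellY0 expr0 !mul0r addr0.
rewrite mulnS pellXD pellYD IHX IHY.
set x := pellX a p; set y := pellY a p.
exists (x * u + (a ^+ 2 - 1) * (t%:Z * x ^+ t.-1 + v * y)).
exists (x * v + y * u); split; first by rewrite (exprS x); ring.
have -> : x ^+ t.+1.-1 = x ^+ t by [].
case: t {IHX IHY} => [|t] /=; first by rewrite expr0; ring.
have -> : t.+2%:Z = t.+1%:Z + 1 :> int by lia.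
by rewrite !(exprS x); ring.
Qed.

Lemma pellY_dvd_mul (a : int) p t : (pellY a p %| pellY a (p * t))%Z.
Proof.
have [u [v [_ ->]]] := pellX_mulS_mod a p t.
by rewrite rpredD ?dvdz_mull // ?expr2 ?dvdz_mull.
Qed.

Lemma pellY_sqr_dvd_mul (a : int) p : 
  (pellY a p ^+ 2 %| pellY a (p * `|pellY a p|%N))%Z.
Proof.
have [u [v [_ ->]]] := pellX_mulS_mod a p `|pellY a p|%N.
set y := pellY a p; rewrite rpredD ?(dvdz_mull v) //.
rewrite mulrAC expr2 dvdz_mulr // dvdz_mul //.
by rewrite dvdzE absz_id.
Qed.

(** With r = q mod p, Y_p divides X_(q-r) Y_r and is coprime to X_(q-r); so it divides Y_r < Y_p,
    which forces r = 0. *)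
Lemma pellY_dvd (a : int) p q : 1 < a -> (0 < p)%N ->
  (pellY a p %| pellY a q)%Z -> (p %| q)%N.
Proof.
move=> a1 p0; rewrite {1}(divn_eq q p) mulnC pellYD => h.
rewrite (rpredDr _ (dvdz_mulr _ (pellY_dvd_mul a p (q %/ p)))) in h.
have cop : coprimez (pellY a p) (pellX a (p * (q %/ p))).
  rewrite coprimez_sym; have := pell_coprime a (p * (q %/ p)).
  by by apply: coprime_dvdr; exact: pellY_dvd_mul.
rewrite Gauss_dvdzr // in h.
have lt : pellY a (q %% p) < pellY a p.
  by rewrite ltNge pellY_mono // -ltnNge ltn_mod.
have ge := pellY_ge0 (q %% p) a1.
have : pellY a (q %% p) = 0.
  case/dvdzP: h lt ge => c ->; move: (pellY a p) => z lt ge.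
  by case: (leP c 0) => c0; nia.
rewrite -(pellY0 a) => /(pellY_inj a1) e.
by rewrite /dvdn e.
Qed.

(** With q = p t, Y_q is t X_p^(t-1) Y_p modulo Y_p^2, and X_p is coprime to Y_p; so Y_p divides
    t. *)
Lemma pellY_sqr_dvd (a : int) p q : 1 < a -> (0 < p)%N ->
  (pellY a p ^+ 2 %| pellY a q)%Z -> (pellY a p %| q%:Z)%Z.
Proof.
move=> a1 p0 h.
have yp0 : pellY a p != 0.
  by rewrite -(pellY0 a) (inj_eq (pellY_inj a1)) -lt0n.
have /dvdnP[t qe] : (p %| q)%N.
  by apply: (pellY_dvd a1) => //; apply: dvdz_trans h; rewrite expr2 dvdz_mulr.
move: h; rewrite {}qe mulnC.
have [u [v [_ ->]]] := pellX_mulS_mod a p t.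
rewrite (rpredDr _ (dvdz_mull v (dvdzz (pellY a p ^+ 2)))) expr2 dvdz_mul2r //.
rewrite Gauss_dvdzl ?coprimezXr 1?coprimez_sym ?pell_coprime // => h.
by rewrite PoszM dvdz_mull.
Qed.

(** * A Diophantine definition of a Pell number with given index *)

(** Modulo X_q, X_(2q) = -1 and Y_(2q) = 0, so shifting the index by 2 q negates Y. *)
Lemma pellY_double_add (a : int) q r :
  (pellX a q %| pellY a (2 * q + r) + pellY a r)%Z.
Proof.
rewrite mul2n -addnn pellYD pellXD pellYD.
set x := pellX a q; set y := pellY a q; set x' := pellX a r;
  set y' := pellY a r.
apply/dvdzP; exists (2 * x * y' + 2 * y * x').
have -> : (a ^+ 2 - 1) * (y * y) = x ^+ 2 - 1.
  by rewrite [x ^+ 2]pell_eq -/y; ring.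
ring.
Qed.

Lemma pellY_double_sub (a : int) q r : (r <= 2 * q)%N ->
  (pellX a q %| pellY a (2 * q - r) - pellY a r)%Z.
Proof.
move=> /pellYB ->; rewrite mul2n -addnn pellYD pellXD.
set x := pellX a q; set y := pellY a q; set x' := pellX a r;
  set y' := pellY a r.
apply/dvdzP; exists (2 * y * x' - 2 * x * y').
have -> : (a ^+ 2 - 1) * (y * y) = x ^+ 2 - 1.
  by rewrite [x ^+ 2]pell_eq -/y; ring.
ring.
Qed.

(** Any index is folded into [0, q] by subtracting 2 q, which flips the sign of Y only, and by
    reflecting r to 2 q - r, which flips the sign of the index only. Hence the two disjunctions are
    independent. *)
Lemma pellY_reduce (a : int) q r : (0 < q)%N -> exists2 u, (u <= q)%N &
  ((2 * q)%:Z %| r%:Z - u%:Z)%Z || ((2 * q)%:Z %| r%:Z + u%:Z)%Z /\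
  (pellX a q %| pellY a r - pellY a u)%Z || (pellX a q %| pellY a r
    + pellY a u)%Z.
Proof.
move=> q0; have [m] := ubnP r; elim: m r => // m IH r rm.
have [rq|qr] := leqP r q.
  by exists r => //; rewrite !subrr !dvdz0.
have [rq|qr2] := leqP r (2 * q).
  exists (2 * q - r)%N; first by lia.
  split; apply/orP; [right | left].
    by have -> : r%:Z + (2 * q - r)%N%:Z = (2 * q)%N by lia.
  by rewrite -opprB rpredN; exact: pellY_double_sub.
have [|u uq [h1 h2]] := IH (r - 2 * q)%N; first by lia.
exists u => //; split.
  case/orP: h1 => h1; apply/orP; [left | right].
    have -> : r%:Z - u%:Z = (2 * q)%N%:Z + ((r - 2 * q)%N%:Z - u%:Z) by lia.
    by rewrite rpredD ?dvdzz.
  have -> : r%:Z + u%:Z = (2 * q)%N%:Z + ((r - 2 * q)%N%:Z + u%:Z) by lia.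
  by rewrite rpredD ?dvdzz.
have := pellY_double_add a q (r - 2 * q); rewrite subnKC; last by lia.
move: (pellY a (r - _)) h2 => z /orP[] h2 h.
  apply/orP; right; have -> : pellY a r + pellY a u =
    pellY a r + z - (z - pellY a u) by ring.
  by rewrite rpredB.
apply/orP; left; have -> : pellY a r - pellY a u =
  pellY a r + z - (z + pellY a u) by ring.
by rewrite rpredB.
Qed.

(** Since a > 2 gives 2 Y_q < X_q, a congruence modulo X_q, up to sign, between Y_p and Y_u with p,
    u <= q is an equality. So p is the folded form of r. *)
Lemma pellY_congr (a : int) p q r : 2 < a -> (0 < q)%N -> (p <= q)%N ->
  (pellX a q %| pellY a r - pellY a p)%Z ->
  ((2 * q)%:Z %| r%:Z - p%:Z)%Z || ((2 * q)%:Z %| r%:Z + p%:Z)%Z.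
Proof.
move=> a2 q0 pq h.
have a1 : 1 < a by lia.
have [u uq [h1 h2]] := pellY_reduce a r q0.
suff -> : p = u by [].
have yp := pellY_ge0 p a1; have yu := pellY_ge0 u a1.
have : pellY a p <= pellY a q by rewrite pellY_mono.
have : pellY a u <= pellY a q by rewrite pellY_mono.
have [_ xq] := pell_ge q a1 => hu hp.
have lt : 2 * pellY a q < pellX a q.
  have yq := pellY_ge0 q a1; clear - a2 xq yq; nia.
have small z : (pellX a q %| z)%Z -> `|z| < pellX a q -> z = 0.
  case/dvdzP=> c ->; move: (pellX a q) => x; clear.
  case: (ltrgt0P c) => [c0|c0|->]; nia.
case/orP: h2 => h2.
  have : pellY a p - pellY a u = 0.
    apply: small; last by clear - hp hu yp yu lt; lia.
    have -> : pellY a p - pellY a u = 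
      (pellY a r - pellY a u) - (pellY a r - pellY a p) by ring.
    by rewrite rpredB.
  by move/eqP; rewrite subr_eq0 => /eqP/(pellY_inj a1).
have e : pellY a p + pellY a u = 0.
  apply: small; last by clear - hp hu yp yu lt; lia.
  have -> : pellY a p + pellY a u = 
    (pellY a r + pellY a u) - (pellY a r - pellY a p) by ring.
  by rewrite rpredB.
by apply: (pellY_inj a1); clear - e yp yu; lia.
Qed.

Definition is_square (z : int) := exists v : int, z = v ^+ 2.

Section StepDown.
Variable R : comNzRingType.
Implicit Types a b c i j y : R.

Definition pnorm a y := (a ^+ 2 - 1) * y ^+ 2 + 1.
(* If E and H are the Pell numbers of index q in base a and of index r in
  base G,
   then a Pell number c of index p divides q because c ^+ 2 divides E; moreover
   G = a and H = c modulo F force r = p or r = - p modulo 2 q, whereas G = 1 and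
   H = b modulo c force r = b modulo c. *)
Definition stepE a c i := c ^+ 2 * pnorm a c * (i + 1).
Definition stepF a c i := pnorm a (stepE a c i).
Definition stepG a c i := a + (a - 1) * stepF a c i * (stepE a c i - 1).
Definition stepH a b c i j := c + stepF a c i * (b + j * c).
Definition stepI a b c i j := pnorm (stepG a c i) (stepH a b c i j).
End StepDown.

Lemma pnorm_ge (a y : int) : 1 < a -> y ^+ 2 < pnorm a y.
Proof. rewrite /pnorm => a1; nia. Qed.

Lemma pnorm_gt0 (a y : int) : 1 < a -> 0 < pnorm a y.
Proof. by move=> a1; exact: le_lt_trans (sqr_ge0 _) (pnorm_ge _ a1). Qed.

Lemma pnorm_pell (a : int) k : pnorm a (pellY a k) = pellX a k ^+ 2.
Proof. by rewrite pell_eq. Qed.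

Lemma pnorm_square (a y : int) : 1 < a -> 0 <= y ->
  is_square (pnorm a y) -> exists k, y = pellY a k.
Proof. by move=> a1 y0 [x e]; apply: (@pell_solution a x y). Qed.

Lemma stepE_gt0 (a c : int) (i : nat) : 1 < a -> 0 < c -> 0 < stepE a c i%:Z.
Proof.
move=> a1 c0; rewrite /stepE; apply: mulr_gt0; last by lia.
apply: mulr_gt0; [by rewrite exprn_gt0 | exact: le_lt_trans (sqr_ge0 _)
  (pnorm_ge _ a1)].
Qed.

(** As F = 1 modulo E, G reduces there to a - (a - 1) = 1. The factor a - 1 in G gives G = 1 modulo
    a - 1, which later yields coprimality with the other square conditions. *)
Lemma stepG_facts (a c : int) (i : nat) : 1 < a -> 0 < c ->
  [/\ (stepE a c i %| stepF a c i - 1)%Z, (stepE a c i %| stepG a c i - 1)%Z,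
      (stepF a c i %| stepG a c i - a)%Z, (a - 1 %| stepG a c i - 1)%Z &
      a <= stepG a c i].
Proof.
move=> a1 c0; have E0 := stepE_gt0 i a1 c0.
have F1 : (stepE a c i %| stepF a c i - 1)%Z.
  by rewrite /stepF /pnorm addrK expr2 mulrA dvdz_mull.
split=> //.
- have -> : stepG a c i - 1 =
  (a - 1) * (stepF a c i * stepE a c i - (stepF a c i - 1)).
    by rewrite /stepG; ring.
  by rewrite dvdz_mull // rpredB // dvdz_mull.
- by rewrite /stepG addrC addKr mulrAC dvdz_mull.
- have -> : stepG a c i - 1 = (a - 1) * (1 + stepF a c i * (stepE a c i - 1)).
    by rewrite /stepG; ring.
  exact: dvdz_mulr.
rewrite /stepG lerDl; have := @pnorm_gt0 a (stepE a c i) a1;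
  rewrite -/(stepF a c i).
by move=> F0; clear F1; apply: mulr_ge0; [apply: mulr_ge0 |]; lia.
Qed.

Lemma step_down (a c : int) (b i j : nat) : 2 < a -> 0 < c ->
  is_square (pnorm a c) -> is_square (stepF a c i%:Z) ->
  is_square (stepI a b%:Z c i%:Z j%:Z) ->
  exists p, [/\ c = pellY a p, (0 < p)%N &
    (c %| b%:Z - p%:Z)%Z || (c %| b%:Z + p%:Z)%Z].
Proof.
move=> a2 c0 sD sF sI; have a1 : 1 < a by lia.
have E0 := stepE_gt0 i a1 c0.
have F0 : 0 < stepF a c i by exact: pnorm_gt0.
have [F1 G1 Ga _ aG] := stepG_facts i a1 c0.
have G2 : 1 < stepG a c i by exact: lt_le_trans aG.
have H0 : 0 <= stepH a b c i j.
  apply: addr_ge0; first exact: ltW.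
  by apply: mulr_ge0; [exact: ltW | apply: addr_ge0 => //; apply: mulr_ge0;
    lia].
have cE : (c ^+ 2 %| stepE a c i)%Z by rewrite /stepE -mulrA dvdz_mulr.
have cE1 : (c %| stepE a c i)%Z by apply: dvdz_trans cE;
  rewrite expr2 dvdz_mulr.
have HC : (stepF a c i %| stepH a b c i j - c)%Z.
  by rewrite /stepH addrC addKr dvdz_mulr.
have HB : (c %| stepH a b c i j - b%:Z)%Z.
  have -> : stepH a b c i j - b%:Z =
    c + stepF a c i * j * c + b%:Z * (stepF a c i - 1).
    by rewrite /stepH; ring.
  rewrite !rpredD ?dvdz_mull //; exact: dvdz_trans F1.
have [p cp] := pnorm_square a1 (ltW c0) sD.
have [q Eq] := pnorm_square a1 (ltW E0) sF.
have [r Hr] := pnorm_square G2 H0 sI.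
have p0 : (0 < p)%N by case: p cp => // cp; move: c0; rewrite cp pellY0 ltxx.
have q0 : (0 < q)%N by case: q Eq => // Eq; move: E0; rewrite Eq pellY0 ltxx.
(* c^2 divides E = Y_q with c = Y_p, hence c divides q; this also gives p <= q. *)
have cq : (c %| q%:Z)%Z.
  by rewrite cp; apply: pellY_sqr_dvd => //; rewrite -cp -Eq.
have pq : (p <= q)%N.
  have := pellY_geid p a1; rewrite -cp; move: cq; rewrite dvdzE => /dvdn_leq.
  by move=> /(_ q0); clear; lia.
exists p; split=> //.
have Fq : stepF a c i = pellX a q ^+ 2 by rewrite /stepF Eq pnorm_pell.
have h : (pellX a q %| pellY a r - pellY a p)%Z.
  apply: (@dvdz_trans (stepF a c i)); first by rewrite Fq expr2 dvdz_mulr.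
  have -> : pellY a r - pellY a p = (stepH a b c i j - c) -
     (pellY (stepG a c i) r - pellY a r) by rewrite Hr cp; ring.
  by rewrite rpredB // pellY_base_dvd.
have rH : (c %| stepH a b c i j - r%:Z)%Z.
  rewrite Hr; apply: dvdz_trans (pellY_id_dvd _ _).
  exact: dvdz_trans G1.
have rb : (c %| r%:Z - b%:Z)%Z.
  have -> : r%:Z - b%:Z = (stepH a b c i j - b%:Z) - (stepH a b c i j - r%:Z)
    by ring.
  by rewrite rpredB.
(* The congruence between r and p or -p modulo 2 q descends to modulus c, where r = b. *)
have c2q : (c %| (2 * q)%N%:Z)%Z by rewrite PoszM dvdz_mull.
case/orP: (pellY_congr a2 q0 pq h) => /(dvdz_trans c2q) hr; apply/orP;
  [left|right].
  have -> : b%:Z - p%:Z = (r%:Z - p%:Z) - (r%:Z - b%:Z) by ring.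
  by rewrite rpredB.
have -> : b%:Z + p%:Z = (r%:Z + p%:Z) - (r%:Z - b%:Z) by ring.
by rewrite rpredB.
Qed.

Lemma step_up (a : int) (b : nat) : 1 < a -> (1 < b)%N ->
  exists i j : nat, is_square (stepF a (pellY a b) i%:Z) /\
    is_square (stepI a b%:Z (pellY a b) i%:Z j%:Z).
Proof.
move=> a1 b1; set c := pellY a b.
have bc : b%:Z < c.
  rewrite /c; case: b b1 {c} => [|[|b]] // _; elim: b => [|b IH].
    by rewrite !pellYS !pellXS pellX0 pellY0; lia.
  by have := pellY_ltS b.+2 a1; lia.
have c0 : 0 < c by lia.
(* As Y_(2b) = 2 X_b c and Y_(2b)^2 divides Y_q, this index makes Y_q a multiple of c^2 X_b^2, that
   is, of [c ^+ 2 * pnorm a c]. *)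
pose q := (2 * b * `|pellY a (2 * b)|)%N.
have q0 : 0 < pellY a q.
  have : 0 < pellY a (2 * b)
    by rewrite -(pellY0 a) ltNge pellY_mono // -ltnNge; lia.
  move=> y0; rewrite -(pellY0 a) ltNge pellY_mono // -ltnNge /q; lia.
have [i Ei] : exists i : nat, stepE a c i%:Z = pellY a q.
  have : (c ^+ 2 * pnorm a c %| pellY a q)%Z.
    apply: dvdz_trans (pellY_sqr_dvd_mul _ _).
    have -> : pellY a (2 * b) = 2 * pellX a b * c.
      by rewrite mul2n -addnn pellYD -/c; ring.
    by rewrite [pnorm _ _]pnorm_pell; apply/dvdzP; exists 4; ring.
  case/dvdzP=> k ek; have k0 : 0 < k.
    have P0 : 0 < c ^+ 2 * pnorm a c by have := stepE_gt0 0 a1 c0;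
      rewrite /stepE; lia.
    by rewrite -(pmulr_lgt0 _ P0) -ek.
  by exists (`|k| - 1)%N; rewrite ek /stepE mulrC; congr (_ * _); lia.
have FX : stepF a c i = pellX a q ^+ 2 by rewrite /stepF Ei pnorm_pell.
exists i.
have E0 := stepE_gt0 i a1 c0.
have F0 : 0 < stepF a c i by exact: pnorm_gt0.
have [F1 G1 Ga _ aG] := stepG_facts i a1 c0.
have cE1 : (c %| stepE a c i)%Z by rewrite /stepE expr2 -!mulrA dvdz_mulr.
(* H is to be the Pell number of index b in base G. So h, the quotient of H - c by F, must have the
   form b + j c with j natural. *)
have /dvdzP[h eh] := pellY_base_dvd b Ga; rewrite -/c in eh.
have h0 : 0 <= h.
  have : c <= pellY (stepG a c i) b.
    rewrite /c; move: (stepG a c i) aG => g ag.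
    have g1 : 1 < g by exact: lt_le_trans a1 ag.
    have ag2 := ag.
    suff [] : pellX a b <= pellX g b /\ pellY a b <= pellY g b by [].
    elim: b {b1 bc q q0 h eh c c0 i Ei FX E0 F0 F1 cE1 Ga G1 ag} =>
      [|b [IHX IHY]] //.
    rewrite !pellXS !pellYS; have := pellX_gt0 b a1; have := pellY_ge0 b a1.
    move: (pellX a b) (pellY a b) (pellX g b) (pellY g b) IHX IHY =>
      x y x' y' hx hy y0 x0.
    have hxx : a * x <= g * x' by apply: ler_pM => //; lia.
    have hyy : a * y <= g * y' by apply: ler_pM => //; lia.
    have : (a ^+ 2 - 1) * y <= (g ^+ 2 - 1) * y' by apply: ler_pM => //; nia.
    lia.
  move=> le; by rewrite -(pmulr_lge0 _ F0) -eh subr_ge0.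
have hb : (c %| h - b%:Z)%Z.
  have : (c %| pellY (stepG a c i) b - b%:Z)%Z.
    apply: dvdz_trans (pellY_id_dvd _ _); exact: dvdz_trans G1.
  have -> : h - b%:Z = (pellY (stepG a c i) b - b%:Z) - c - h * (stepF a c i
    - 1).
    by rewrite mulrBr mulr1 -eh; ring.
  move=> h1; apply: rpredB; first by apply: rpredB => //; exact: dvdzz.
  by apply: dvdz_mull; exact: dvdz_trans F1.
case/dvdzP: hb => k ek.
(* h = b + k c is nonnegative and b < c, so k > -1. *)
have k0 : 0 <= k by rewrite leNgt; apply/negP => k0; clear - ek h0 k0 bc; nia.
exists `|k|%N; split; first by exists (pellX a q).
exists (pellX (stepG a c i) b); rewrite -pnorm_pell /stepI; congr pnorm.
rewrite /stepH gez0_abs // -ek [b%:Z + _]addrC subrK mulrC -eh; ring.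
Qed.

(** * Combining square conditions *)

(** A is gcd(A, v)^2: by Bezout A divides this square, as A divides v^2; conversely the square
    divides v^2 = A B and is coprime to B. *)
Lemma square_gcd (A B : int) : 0 <= A -> coprimez A B ->
  is_square (A * B) -> is_square A.
Proof.
move=> A0 cop [v e]; exists (gcdz A v); apply/eqP.
suff : `|A|%N = `|gcdz A v ^+ 2|%N by have := sqr_ge0 (gcdz A v); lia.
apply/eqP; rewrite eqn_dvd; apply/andP; split; rewrite -dvdzE.
  have [p [q <-]] := Bezoutz A v.
  have -> : (p * A + q * v) ^+ 2 =
    A * (p ^+ 2 * A + 2 * p * q * v) + q ^+ 2 * v ^+ 2.
    by ring.
  by apply: rpredD; [exact: dvdz_mulr | rewrite -e mulrCA dvdz_mulr].
rewrite -(@Gauss_dvdzl _ _ B) ?e ?dvdz_pexp2r ?dvdz_gcdr //.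
by rewrite coprimezXl // /coprimez; apply: coprime_dvdl cop; exact: dvdz_gcdl.
Qed.

Lemma square_dvd (A x z : int) : x != 0 -> A * x ^+ 2 = z ^+ 2 -> is_square A.
Proof.
move=> x0 e; have /dvdzP[c ec] : (x %| z)%Z.
  by rewrite -(@dvdz_pexp2r _ _ 2) // -e dvdz_mull.
exists c; apply: (mulIf (expf_neq0 2 x0)); rewrite e ec; ring.
Qed.

(* The shared unknown is v = sqrt A + (1 + A) sqrt B.  Conversely, the equation
   makes A * B a square, and then A * v ^+ 2 is a square as well;
     v is nonzero as
   A < (1 + A) ^+ 2 * B. *)
Lemma two_squares (A B : int) : 0 < A -> 0 < B ->
  (is_square A /\ is_square B) <->
  exists v : nat, (v%:Z ^+ 2 - A - B * (1 + A) ^+ 2) ^+ 2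
                  = 4 * A * B * (1 + A) ^+ 2.
Proof.
move=> A0 B0; split=> [[[a ea] [b eb]] | [v ev]].
  have z0 : 0 <= `|a| + `|b| * (1 + A) by rewrite addr_ge0 ?mulr_ge0 //; lia.
  exists (absz (`|a| + `|b| * (1 + A))); rewrite gez0_abs //.
  have e2 (x : int) : `|x| ^+ 2 = x ^+ 2 by rewrite -normrX ger0_norm ?sqr_ge0.
  have -> : 4 * A * B * (1 + A) ^+ 2 = (2 * `|a| * `|b| * (1 + A)) ^+ 2.
    by rewrite {1}ea eb -(e2 a) -(e2 b); ring.
  congr (_ ^+ 2); have -> : B = `|b| ^+ 2 by rewrite e2.
  by have := e2 a; rewrite -ea => <-; ring.
set W := 1 + A in ev; have W0 : W != 0 by rewrite /W; lia.
have [c ec] : is_square (A * B).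
  apply: (@square_dvd _ (2 * W) (v%:Z ^+ 2 - A - B * W ^+ 2));
    last by rewrite ev; ring.
  by rewrite mulf_neq0.
have [d [ed ev']] : exists d, A * B = d ^+ 2 /\ v%:Z ^+ 2 =
  A + B * W ^+ 2 + 2 * d * W.
  have : (v%:Z ^+ 2 - A - B * W ^+ 2) ^+ 2 == (2 * c * W) ^+ 2.
    rewrite ev; apply/eqP; transitivity (4 * (A * B) * W ^+ 2); first by ring.
    by rewrite ec; ring.
  rewrite eqf_sqr => /orP[] /eqP h.
    by exists c; split => //; lia.
  by exists (- c); rewrite sqrrN; split => //; lia.
have eA : A * v%:Z ^+ 2 = (A + d * W) ^+ 2.
  transitivity (A ^+ 2 + A * B * W ^+ 2 + 2 * A * d * W);
    first by rewrite ev'; ring.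
  by rewrite ed; ring.
have v0 : v%:Z != 0.
  apply/eqP => v0; move: eA; rewrite v0 expr0n mulr0 => /esym/eqP.
  rewrite sqrf_eq0 => /eqP h.
  have : A ^+ 2 = A * B * W ^+ 2
    by rewrite ed [X in X ^+ 2](_ : A = - (d * W)); [ring | lia].
  rewrite expr2 -mulrA => /(mulfI (lt0r_neq0 A0)).
  clear - A0 B0; rewrite /W; nia.
have sA : is_square A by apply: square_dvd eA.
split=> //; case: sA => u eu; apply: (@square_dvd _ u d);
  last by rewrite -ed eu mulrC.
by apply/eqP => u0; move: A0; rewrite eu u0 expr0n.
Qed.

(* Here v = (2 d - 1) (1 + A + sqrt A), whose sign is that of 2 d - 1 since
   |sqrt A| < 1 + A. *)
Lemma square_and_pos (A d : int) : 0 < A ->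
  (is_square A /\ 0 < d) <->
  exists v : nat, (v%:Z - (2 * d - 1) * (1 + A)) ^+ 2 = (2 * d - 1) ^+ 2 * A.
Proof.
move=> A0; split=> [[[a ea] d0] | [v ev]].
  exists (absz ((2 * d - 1) * (1 + A + `|a|))).
  rewrite gez0_abs; last by apply: mulr_ge0; lia.
  have -> : A = `|a| ^+ 2 by rewrite ea -normrX ger0_norm ?sqr_ge0.
  ring.
(* 2 d - 1 is odd, hence never zero, and it is positive exactly when d is. *)
have d1 : 2 * d - 1 != 0 by lia.
have /dvdzP[c ec] : (2 * d - 1 %| v%:Z - (2 * d - 1) * (1 + A))%Z.
  by rewrite -(@dvdz_pexp2r _ _ 2) // ev dvdz_mulr.
have ea : A = c ^+ 2.
  apply: (mulfI (expf_neq0 2 d1)); rewrite -ev ec; ring.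
split; first by exists c.
have cA : `|c| < 1 + A by rewrite ea; clear; nia.
have : 0 <= (1 + A + c) * (2 * d - 1).
  have -> : (1 + A + c) * (2 * d - 1) = v%:Z by rewrite mulrDl -ec; ring.
  by [].
by rewrite pmulr_rge0; clear - cA; lia.
Qed.

(** * Binomial coefficients as digits of a quotient of Pell numbers *)

Lemma base_expansion_lt (U s : nat) (f : nat -> nat) :
  (forall i, f i < U)%N -> (\sum_(0 <= i < s) f i * U ^ i < U ^ s)%N.
Proof.
move=> fU; elim: s => [|s IH]; first by rewrite big_nil expn0.
rewrite big_nat_recr //= expnS.
have : ((f s).+1 * U ^ s <= U * U ^ s)%N by rewrite leq_mul2r fU orbT.
by rewrite mulSn; lia.
Qed.

Lemma binomial_digit (U n s : nat) : (2 ^ n < U)%N -> (s <= n)%N ->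
  ((U.+1 ^ n) %/ U ^ s %% U = 'C(n, s))%N.
Proof.
move=> hU sn.
have CU i : ('C(n, i) < U)%N.
  apply: leq_ltn_trans hU; have [le|lt] := leqP i n; last by rewrite bin_small.
  have := expnDn 1 1 n; rewrite addn1 => ->.
  by rewrite (bigD1 (Ordinal (le : i < n.+1)%N)) //= !exp1n !muln1 leq_addr.
have -> : (U.+1 ^ n = \sum_(0 <= i < n.+1) 'C(n, i) * U ^ i)%N.
  by rewrite -add1n expnDn big_mkord; apply: eq_bigr => i _;
    rewrite exp1n mul1n.
rewrite (big_cat_nat _ (n := s)) //=; last exact: leqW.
rewrite [X in ((_ + X) %/ _)%N]big_ltn //.
have /dvdnP[K ->] : (U ^ s.+1 %| \sum_(s.+1 <= i < n.+1) 'C(n, i) * U ^ i)%N.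
  rewrite big_nat; apply: dvdn_sum => i /andP[si _].
  by rewrite dvdn_mull // dvdn_exp2l.
have -> : ('C(n, s) * U ^ s + K * U ^ s.+1 = ('C(n, s) + K * U) * U ^ s)%N.
  by rewrite expnS; ring.
have U0 : (0 < U ^ s)%N by rewrite expn_gt0; apply/orP; left; lia.
rewrite divnDMl // divn_small ?base_expansion_lt // add0n.
by rewrite addnC modnMDl modn_small.
Qed.

(** (U + 1)^n is 1 modulo U. This keeps (U + 1)^n / U^s strictly above its integer part, leaving
    room for the approximation error. *)
Lemma expn_succ_not_dvd (U n s : nat) : (1 < U)%N -> (0 < s)%N ->
  ~~ (U ^ s %| U.+1 ^ n)%N.
Proof.
move=> U1 s0; apply/negP => /(dvdn_trans (dvdn_exp s0 (dvdnn U))).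
by rewrite /dvdn -modnXm -addn1 modnDl modnXm exp1n modn_small.
Qed.

Lemma expn_succ_le (V n : nat) : (0 < V)%N ->
  (V * V.+1 ^ n <= (V + 2 ^ n) * V ^ n)%N.
Proof.
(* The induction needs the sharper bound (1 + 1/V)^n <= 1 + (2^n - 1)/V. *)
move=> V0; suff : (V * V.+1 ^ n + V ^ n <= (V + 2 ^ n) * V ^ n)%N by lia.
elim: n => [|n IH]; first by rewrite !expn0; lia.
have := leq_mul IH (leqnn V.+1); rewrite !expnS.
have : (0 < 2 ^ n)%N by rewrite expn_gt0.
move: (V.+1 ^ n)%N (V ^ n)%N (2 ^ n)%N => x y [|z] // _ h.
have := leq_pmull (y * z) V0; nia.
Qed.

(** C / Q differs from P / Z, where P = (U + 1)^n and Z = U^s, by at most a factor (1 + 1/V)^n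
    either way. For V > (2 U + 2)^n this moves P by less than 1, while P is at distance at least 1
    from every multiple of Z. *)
Lemma quotient_approx (V U n s : nat) (C Q : int) :
  (1 < U)%N -> (0 < s)%N -> ((2 * U.+1) ^ n < V)%N ->
  ((2 * V) ^ n * U.+1 ^ n)%N%:Z <= C <= ((2 * V.+1) ^ n * U.+1 ^ n)%N%:Z ->
  ((2 * V) ^ n * U ^ s)%N%:Z <= Q <= ((2 * V.+1) ^ n * U ^ s)%N%:Z ->
  let T := ((U.+1 ^ n) %/ U ^ s)%N%:Z in T * Q < C /\ C < (T + 1) * Q.
Proof.
move=> U1 s0 hV hC hQ /=.
have := expn_succ_not_dvd n U1 s0; rewrite /dvdn.
have := divn_eq (U.+1 ^ n) (U ^ s);
  have Z0 : (0 < U ^ s)%N by rewrite expn_gt0; lia.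
have := ltn_pmod (U.+1 ^ n) Z0.
set T := (_ %/ _)%N; set r := (_ %% _)%N => rZ eP r0.
have key : ((V.+1 ^ n - V ^ n) * U.+1 ^ n < V ^ n)%N.
  have h2 : (2 ^ n * U.+1 ^ n < V)%N by rewrite -expnMn.
  have h3 : (0 < V ^ n)%N by rewrite expn_gt0; lia.
  have V0 : (0 < V)%N by lia.
  have h1 := expn_succ_le n V0.
  rewrite -(ltn_pmul2l V0).
  apply: (@leq_ltn_trans (2 ^ n * V ^ n * U.+1 ^ n)%N).
    rewrite mulnA leq_mul2r; apply/orP; right; rewrite mulnBr; lia.
  by rewrite mulnAC mulnC (mulnC V) ltn_pmul2l.
have AB : (V ^ n <= V.+1 ^ n)%N by case: (n) => [|k] //; rewrite leq_exp2r.
move: hC hQ; rewrite !expnMn.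
have w0 : (0 < 2 ^ n)%N by rewrite expn_gt0.
move: (2 ^ n)%N (V ^ n)%N (V.+1 ^ n)%N (U.+1 ^ n)%N (U ^ s)%N w0 AB key Z0 rZ
  eP r0.
move=> w A B P Z w0 AB key Z0 rZ eP r0 /andP[C1 C2] /andP[Q1 Q2].
have k1 : (w * B * P < w * A * (P + 1))%N.
  rewrite -!mulnA ltn_pmul2l //; nia.
have k2 : (w * B * (P - 1) < w * A * P)%N.
  rewrite -!mulnA ltn_pmul2l //; nia.
(* Both bounds use that the remainder of P modulo Z is nonzero. *)
have t1 : (T * Z <= P - 1)%N by lia.
have t2 : (P + 1 <= (T + 1) * Z)%N by rewrite eP; lia.
have t1' : (w * B * (T * Z) <= w * B * (P - 1))%N by rewrite leq_mul2l t1 orbT.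
have t2' : (w * A * (P + 1) <= w * A * ((T + 1) * Z))%N
  by rewrite leq_mul2l t2 orbT.
split.
  apply: (@le_lt_trans _ _ (T%:Z * (w * B * Z)%N%:Z));
    first by apply: ler_pM => //; lia.
  apply: lt_le_trans C1; rewrite -PoszM ltz_nat.
  by apply: leq_ltn_trans k2; apply: leq_trans t1'; lia.
apply: (@lt_le_trans _ _ ((T%:Z + 1) * (w * A * Z)%N%:Z));
  last by apply: ler_wpM2l.
apply: le_lt_trans C2 _; rewrite -[T%:Z + 1]/(T + 1)%N%:Z -PoszM ltz_nat.
by apply: leq_trans k1 _; apply: leq_trans t2' _; lia.
Qed.

(** * Indices determined by residues, and forcing large parameters *)

Lemma pellY_index (a : int) k (t : nat) : 1 < a -> t%:Z < a - 1 ->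
  (a - 1 %| pellY a k - t%:Z)%Z -> pellY a k < pellY a `|a - 1|%N -> k = t.
Proof.
move=> a1 ta h lt.
have ka : (k < `|a - 1|)%N by rewrite ltnNge -(pellY_mono a1) -ltNge.
have : (a - 1 %| k%:Z - t%:Z)%Z.
  have -> : k%:Z - t%:Z = (pellY a k - t%:Z) - (pellY a k - k%:Z) by ring.
  by rewrite rpredB // pellY_id_dvd.
case/dvdzP=> c ec; clear - ec ka ta a1.
case: (ltrgt0P c) => [c0|c0|c0]; [nia|nia|].
by move: ec; rewrite c0; lia.
Qed.

(** In base a = k + 3 the index is a positive multiple of a - 1 = k + 2, so (k + 2) m >= (2 a -
    1)^(k+1) >= (k + 3)^(k+1); one factor k + 3 absorbs k + 2. *)
Lemma pell_large (k : nat) (m : int) : 0 < m ->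
  is_square (pnorm (k%:Z + 3) ((k%:Z + 2) * m)) -> (k%:Z + 3) ^+ k <= m.
Proof.
move=> m0 sq; have a1 : 1 < k%:Z + 3 :> int by lia.
have y0 : 0 <= (k%:Z + 2) * m by apply: mulr_ge0; lia.
have [r er] := pnorm_square a1 y0 sq.
have r0 : (0 < r)%N.
  case: r er => // /eqP; rewrite pellY0 mulf_eq0 => /orP[] /eqP; lia.
have : (k%:Z + 2 %| r%:Z)%Z.
  have -> : r%:Z = (k%:Z + 2) * m - (pellY (k%:Z + 3) r - r%:Z)
    by rewrite er; ring.
  rewrite rpredB ?dvdz_mulr //.
  by have := pellY_id_dvd (k%:Z + 3) r; rewrite -addrA.
rewrite dvdzE => /dvdn_leq => /(_ r0) /= h.
have kr : (k.+2 <= r)%N by clear - h; lia.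
have : pellY (k%:Z + 3) k.+2 <= (k%:Z + 2) * m by rewrite er pellY_mono.
move/(le_trans (pellY_lb k.+1 a1)).
have h1 : (k%:Z + 3) ^+ k.+1 <= (2 * (k%:Z + 3) - 1) ^+ k.+1
  by rewrite lerXn2r ?nnegrE; lia.
move/(le_trans h1) => {}h1.
have k2 : 0 < k%:Z + 2 :> int by lia.
rewrite -(ler_pM2l k2); apply: le_trans h1; rewrite exprS.
by apply: ler_pM => //; rewrite ?exprn_ge0 //; lia.
Qed.

Lemma pell_unbounded (k b : nat) :
  exists2 m : nat, (b < m)%N & is_square (pnorm (k%:Z + 3) ((k%:Z + 2) * m%:Z)).
Proof.
have a1 : 1 < k%:Z + 3 :> int by lia.
(* An index divisible by k + 2 makes Y_r divisible by k + 2, and Y_r >= r makes the quotient exceed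
   b. *)
pose r := ((k + 2) * b.+1)%N.
have : (k%:Z + 2 %| pellY (k%:Z + 3) r)%Z.
  have -> : pellY (k%:Z + 3) r = (pellY (k%:Z + 3) r - r%:Z) + r%:Z by ring.
  apply: rpredD; last by rewrite /r PoszM dvdz_mulr.
  by have := pellY_id_dvd (k%:Z + 3) r; rewrite -addrA.
case/dvdzP=> c ec.
have := pellY_geid r a1; rewrite ec /r => h.
have cb : b%:Z < c by clear - h; nia.
exists `|c|%N; first by lia.
rewrite gez0_abs; last by lia.
by rewrite [_ * c]mulrC -ec pnorm_pell; exists (pellX (k%:Z + 3) r).
Qed.

Lemma coprimez_congr (A B C : int) :
  coprimez A B -> (A %| C - B)%Z -> coprimez A C.
Proof.
move=> /coprimezP[[p q] /= e] /dvdzP[k ek]; apply/coprimezP.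
by exists (p - q * k, q); rewrite /= -[RHS]e (_ : C = B + k * A); [ring | lia].
Qed.

Lemma coprimez_congr1 (A B : int) : (A %| B - 1)%Z -> coprimez A B.
Proof. by apply: coprimez_congr; rewrite coprimezE coprimen1. Qed.

Lemma pnorm_congr1 (d a y : int) : (d %| a - 1)%Z -> (d %| pnorm a y - 1)%Z.
Proof.
move=> h; rewrite /pnorm addrK.
have -> : (a ^+ 2 - 1) * y ^+ 2 = (a + 1) * y ^+ 2 * (a - 1) by ring.
exact: dvdz_mull.
Qed.

Lemma square_mul (A B : int) : 0 < A -> 0 < B -> coprimez A B ->
  is_square (A * B) <-> is_square A /\ is_square B.
Proof.
move=> A0 B0 cop; split=> [h | [[u ->] [v ->]]]; last first.
  by exists (u * v); rewrite exprMn.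
split; first by apply: (@square_gcd A B) => //; exact: ltW.
apply: (@square_gcd B A); [exact: ltW | by rewrite coprimez_sym |
  by rewrite mulrC].
Qed.

Definition step_prod {R : comNzRingType} (a b c i j : R) :=
  pnorm a c * (stepF a c i * stepI a b c i j).

(** With D = [pnorm a c], coprimality comes from congruences: F = 1 and I = 1 modulo D, since D
    divides E; I = D modulo F, since G = a and H = c there; and D, F, I are all 1 modulo P, since P
    divides a - 1. *)
Lemma step_prod_square (a c P : int) (b i j : nat) :
  1 < a -> 0 < c -> 0 < P -> (P %| a - 1)%Z ->
  is_square (P * step_prod a b%:Z c i%:Z j%:Z) <->
  is_square P /\ [/\ is_square (pnorm a c), is_square (stepF a c i%:Z) &
                    is_square (stepI a b%:Z c i%:Z j%:Z)].
Proof.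
move=> a1 c0 P0 Pa; have [F1 G1 Ga Ga1 aG] := stepG_facts i a1 c0.
have D0 : 0 < pnorm a c by exact: pnorm_gt0.
have F0 : 0 < stepF a c i by exact: pnorm_gt0.
have I0 : 0 < stepI a b c i j by apply: pnorm_gt0; exact: lt_le_trans aG.
have DE : (pnorm a c %| stepE a c i)%Z by rewrite /stepE mulrAC dvdz_mull.
have cDF : coprimez (pnorm a c) (stepF a c i).
  by apply: coprimez_congr1; exact: dvdz_trans F1.
have cFI : coprimez (stepF a c i) (stepI a b c i j).
  apply: (@coprimez_congr _ (pnorm a c)); first by rewrite coprimez_sym.
  rewrite /stepI /pnorm.
  have -> : (stepG a c i ^+ 2 - 1) * stepH a b c i j ^+ 2
    + 1 - ((a ^+ 2 - 1) * c ^+ 2 + 1) =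
    (stepG a c i - a) * ((stepG a c i + a) * stepH a b c i j ^+ 2)
    + stepF a c i * ((a ^+ 2 - 1) * (b%:Z + j%:Z * c) * (stepH a b c i j + c)).
    by rewrite /stepH; ring.
  by rewrite rpredD // dvdz_mulr.
have cDI : coprimez (pnorm a c) (stepI a b c i j).
  by apply: coprimez_congr1; apply: pnorm_congr1; exact: dvdz_trans G1.
have cP : coprimez P (step_prod a b%:Z c i%:Z j%:Z).
  rewrite /step_prod !coprimezMr; apply/and3P; split; apply: coprimez_congr1;
    apply: pnorm_congr1 => //; exact: dvdz_trans Ga1.
rewrite square_mul //; last by rewrite !mulr_gt0.
rewrite square_mul ?mulr_gt0 //; last by rewrite coprimezMr cDF.
rewrite square_mul //; split; first by case=> ? [? []].
by case=> ? [].
Qed.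

Lemma pellY_ge_double (a : int) k : 1 < a -> (1 < k)%N -> 2 * k%:Z <= pellY a k.
Proof.
move=> a1; case: k => [|[|k]] // _; elim: k => [|k IH].
  by rewrite !pellYS pellXS pellX0 pellY0; lia.
have := pellX_gt0 k.+2 a1; have := pellYS a k.+2; move: IH.
move: (pellY a k.+3) (pellY a k.+2) (pellX a k.+2) => y' y x h1 h2 h3.
have : 0 <= (a - 2) * y by apply: mulr_ge0; lia.
rewrite h2 mulrBl; lia.
Qed.

(** The index p of c is n + 1 modulo a - 1, so p = n + 1 or p > n + 1. In the second case both p -
    (n + 1) and p + (n + 1) lie strictly between 0 and 2 p <= c, so c divides neither. *)
Lemma step_down_index (a c : int) (n i j : nat) :
  2 < a -> 0 < c -> n.+1%:Z < a - 1 -> (a - 1 %| c - n.+1%:Z)%Z ->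
  is_square (pnorm a c) -> is_square (stepF a c i%:Z) ->
  is_square (stepI a n.+1%:Z c i%:Z j%:Z) -> c = pellY a n.+1.
Proof.
move=> a2 c0 na ca sD sF sI; have a1 : 1 < a by exact: lt_trans a2.
have [p [cp p0 h]] := step_down a2 c0 sD sF sI.
have : (a - 1 %| p%:Z - n.+1%:Z)%Z.
  have -> : p%:Z - n.+1%:Z = (c - n.+1%:Z) - (pellY a p - p%:Z)
    by rewrite cp; ring.
  by rewrite rpredB // pellY_id_dvd.
case/dvdzP=> e ee.
case: (ltrgt0P e) => e0; last first.
- by rewrite cp; congr pellY; move: ee; rewrite e0; clear; lia.
- exfalso; clear - e0 ee na p0; nia.
exfalso.
have np : (n.+1 < p)%N by clear - e0 ee na; nia.
have c2 : 2 * p%:Z <= c by rewrite cp; apply: pellY_ge_double => //;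
  clear - np; lia.
case/orP: h => /dvdzP[d ed]; clear - np c2 ed;
  case: (ltrgt0P d) => d0; try nia; move: ed; rewrite d0; lia.
Qed.

(** v^(2n) <= v^(v-1) < (2 b - 1)^(v-1) <= Y_b(v) <= Y_b(b - 1). *)
Lemma pell_index_bound (b c : int) (v n : nat) : v%:Z + 1 <= b ->
  (1 < v)%N -> (2 * n < v)%N -> c <= (v%:Z ^+ 2) ^+ n -> c < pellY b `|b - 1|%N.
Proof.
move=> vb v1 nv /le_lt_trans; apply.
case: v vb v1 nv => // v vb v1 nv; have b1 : 1 < b by lia.
have h : pellY b v.+1 <= pellY b `|b - 1|%N by rewrite pellY_mono //; lia.
apply: lt_le_trans h; apply: lt_le_trans (pellY_lb v b1).
apply: (@le_lt_trans _ _ (v.+1%:Z ^+ v)).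
  by rewrite -exprM ler_weXn2l; lia.
case: v vb v1 nv => // v vb v1 nv.
by rewrite ltrXn2r ?nnegrE //; lia.
Qed.

Lemma PoszX (x k : nat) : (x ^ k)%N%:Z = x%:Z ^+ k.
Proof. by elim: k => // k IH; rewrite expnS PoszM IH exprS. Qed.

Lemma pell_quotient (a b g : int) (u v n s : nat) :
  (1 < u)%N -> (0 < s)%N -> (s <= n)%N -> ((2 * u.+1) ^ n < v)%N ->
  a = v%:Z * (u%:Z + 1) + 1 -> b = v%:Z * u%:Z + 1 -> g = v%:Z + 1 ->
  let T := ((u.+1 ^ n) %/ u ^ s)%N%:Z in
  let Q := pellY b s.+1 * pellY g (n - s).+1 in
  T * Q < pellY a n.+1 /\ pellY a n.+1 < (T + 1) * Q.
Proof.
move=> u1 s0 sn hv ea eb eg; have v0 : (0 < v)%N by lia.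
have v0' : 0 < v%:Z :> int by lia.
have u0' : 0 < u%:Z :> int by lia.
have vu0 : 0 < v%:Z * u%:Z by exact: mulr_gt0.
have a1 : 1 < a by lia.
have b1 : 1 < b by lia.
have g1 : 1 < g by lia.
have pow (x y : int) k : 0 <= x -> x <= y -> x ^+ k <= y ^+ k.
  by move=> x0 xy; rewrite lerXn2r ?nnegrE //; exact: le_trans xy.
have PoszX (x k : nat) : (x ^ k)%N%:Z = x%:Z ^+ k by elim: k => // k IH;
  rewrite expnS PoszM IH exprS.
apply: (@quotient_approx v) => //.
  rewrite -!expnMn !PoszX; apply/andP; split.
    apply: le_trans (pellY_lb n a1); apply: pow => //; rewrite ea; clear; nia.
  apply: le_trans (pellY_ub n a1) _; apply: pow; rewrite ea; clear; nia.
(* Distributes the power over the two factors of Q, of degrees s and n - s. *)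
have split_exp w : ((2 * w) ^ n * u ^ s =
  (2 * w * u) ^ s * (2 * w) ^ (n - s))%N.
  by rewrite [((_ * u) ^ s)%N]expnMn mulnAC -expnD subnKC.
rewrite !split_exp !PoszM !PoszX; apply/andP; split; apply: ler_pM;
  rewrite ?exprn_ge0 ?pellY_ge0 //.
- apply: le_trans (pellY_lb s b1); apply: pow => //; rewrite eb; clear - u0';
  nia.
- apply: le_trans (pellY_lb (n - s) g1); apply: pow => //; rewrite eg; clear;
  lia.
- apply: le_trans (pellY_ub s b1) _; apply: pow; rewrite eb; clear - u0'; nia.
- apply: le_trans (pellY_ub (n - s) g1) _; apply: pow; rewrite eg; clear; lia.
Qed.

(** * The polynomial *)

Section BinomialPolynomial.
Variable R : comNzRingType.
Implicit Types A B P C L N Q T a b g d u v y n s x w k l m i j t p q : R.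

Definition pair_poly A B v :=
  (v ^+ 2 - A - B * (1 + A) ^+ 2) ^+ 2 - 4 * A * B * (1 + A) ^+ 2.

Definition pos_poly A d v :=
  (v - (2 * d - 1) * (1 + A)) ^+ 2 - (2 * d - 1) ^+ 2 * A.

(** The second factor is 4 ((T + 1) Q - C) (C - T Q), positive for Q > 0 exactly when T < C / Q < T
    + 1. The factor y also forces y > 0, from which C >= Q will follow. *)
Definition quotient_gap y T C Q :=
  y * (Q ^+ 2 - (2 * C - (2 * T + 1) * Q) ^+ 2).

(* The polynomial is cut into stages, each naming a few subexpressions, so that
   no term with all the subexpressions expanded is ever formed. *)
Definition value_poly P a b g C L N u y n i j t p q :=
  pair_poly (pnorm b L) (P * step_prod a (n + 1) C i j) p ^+ 2
  + pos_poly (pnorm g N) (quotient_gap y (y + t * u) C (L * N)) q ^+ 2.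

Definition base_poly P a b g u y n s k l m i j t p q :=
  value_poly P a b g (n + 1 + k * (a - 1)) (s + 1 + l * (b - 1))
    (n - s + 1 + m * (g - 1)) u y n i j t p q.

Definition scale_poly P v u y n s k l m i j t p q :=
  base_poly P (v * (u + 1) + 1) (v * u + 1) (v + 1) u y n s k l m i j t p q.

(** V is a multiple of P1 P2, so P1 P2 divides a - 1 = V (U + 1), as the coprimality argument
    requires. *)
Definition size_poly P1 P2 w u y n s k l m i j t p q :=
  scale_poly (P1 * P2) (P1 * P2 * (w + 1)) u y n s k l m i j t p q.

(** The base P1 + 1 makes P2 = 1 modulo P1, so the two are coprime; P2 being a square forces w + 1
    to be large. *)
Definition digit_poly P1 u y n s w k l m i j t p q :=
  size_poly P1 (pnorm (P1 + 1) (P1 * (w + 1))) w u y n s k l m i j t p q.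

Definition sized_poly u y n s w k l m i j t p q :=
  digit_poly (pnorm (n + 3) ((n + 2) * u)) u y n s w k l m i j t p q.

Definition binomial_poly y n s x w k l m i j t p q :=
  sized_poly (y + 1 + x) y n s w k l m i j t p q.

End BinomialPolynomial.

(** * Compatibility with ring morphisms *)

Section Morphism.
Variables (R S : comNzRingType) (f : {rmorphism R -> S}).

Let rmorphE := (rmorphD f, rmorphN f, rmorphM f, rmorphXn f, rmorph1 f,
  rmorph_nat f).

Lemma rmorph_pnorm a y : f (pnorm a y) = pnorm (f a) (f y).
Proof. by rewrite /pnorm !rmorphE. Qed.

Lemma rmorph_stepE a c i : f (stepE a c i) = stepE (f a) (f c) (f i).
Proof. by rewrite /stepE !(rmorph_pnorm, rmorphE). Qed.

Lemma rmorph_stepF a c i : f (stepF a c i) = stepF (f a) (f c) (f i).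
Proof. by rewrite /stepF rmorph_pnorm rmorph_stepE. Qed.

Lemma rmorph_stepG a c i : f (stepG a c i) = stepG (f a) (f c) (f i).
Proof. by rewrite /stepG !(rmorph_stepF, rmorph_stepE, rmorphE). Qed.

Lemma rmorph_stepH a b c i j :
  f (stepH a b c i j) = stepH (f a) (f b) (f c) (f i) (f j).
Proof. by rewrite /stepH !(rmorph_stepF, rmorphE). Qed.

Lemma rmorph_stepI a b c i j :
  f (stepI a b c i j) = stepI (f a) (f b) (f c) (f i) (f j).
Proof. by rewrite /stepI rmorph_pnorm rmorph_stepG rmorph_stepH. Qed.

Lemma rmorph_step_prod a b c i j :
  f (step_prod a b c i j) = step_prod (f a) (f b) (f c) (f i) (f j).
Proof.
by rewrite /step_prod !(rmorph_stepI, rmorph_stepF, rmorph_pnorm, rmorphE).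
Qed.

Lemma rmorph_pair_poly A B v : f (pair_poly A B v) =
  pair_poly (f A) (f B) (f v).
Proof. by rewrite /pair_poly !rmorphE. Qed.

Lemma rmorph_pos_poly A d v : f (pos_poly A d v) = pos_poly (f A) (f d) (f v).
Proof. by rewrite /pos_poly !rmorphE. Qed.

Lemma rmorph_quotient_gap y T C Q :
  f (quotient_gap y T C Q) = quotient_gap (f y) (f T) (f C) (f Q).
Proof. by rewrite /quotient_gap !rmorphE. Qed.

Lemma rmorph_value_poly P a b g C L N u y n i j t p q :
  f (value_poly P a b g C L N u y n i j t p q) =
  value_poly (f P) (f a) (f b) (f g) (f C) (f L) (f N) (f u) (f y) (f n) (f i)
    (f j) (f t) (f p) (f q).
Proof.
rewrite /value_poly rmorphD 2!rmorphXn rmorph_pair_poly rmorph_pos_poly.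
rewrite 2!rmorph_pnorm rmorphM rmorph_step_prod rmorph_quotient_gap.
by rewrite !rmorphE.
Qed.

Lemma rmorph_base_poly P a b g u y n s k l m i j t p q :
  f (base_poly P a b g u y n s k l m i j t p q) =
  base_poly (f P) (f a) (f b) (f g) (f u) (f y) (f n) (f s) (f k) (f l) (f m)
    (f i) (f j) (f t) (f p) (f q).
Proof. by rewrite /base_poly rmorph_value_poly !rmorphE. Qed.

Lemma rmorph_scale_poly P v u y n s k l m i j t p q :
  f (scale_poly P v u y n s k l m i j t p q) =
  scale_poly (f P) (f v) (f u) (f y) (f n) (f s) (f k) (f l) (f m) (f i) (f j)
    (f t) (f p) (f q).
Proof. by rewrite /scale_poly rmorph_base_poly !rmorphE. Qed.

Lemma rmorph_size_poly P1 P2 w u y n s k l m i j t p q :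
  f (size_poly P1 P2 w u y n s k l m i j t p q) =
  size_poly (f P1) (f P2) (f w) (f u) (f y) (f n) (f s) (f k) (f l) (f m) (f i)
    (f j) (f t) (f p) (f q).
Proof. by rewrite /size_poly rmorph_scale_poly !rmorphE. Qed.

Lemma rmorph_digit_poly P1 u y n s w k l m i j t p q :
  f (digit_poly P1 u y n s w k l m i j t p q) =
  digit_poly (f P1) (f u) (f y) (f n) (f s) (f w) (f k) (f l) (f m) (f i) (f j)
    (f t) (f p) (f q).
Proof. by rewrite /digit_poly rmorph_size_poly rmorph_pnorm !rmorphE. Qed.

Lemma rmorph_sized_poly u y n s w k l m i j t p q :
  f (sized_poly u y n s w k l m i j t p q) =
  sized_poly (f u) (f y) (f n) (f s) (f w) (f k) (f l) (f m) (f i) (f j) (f t)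
    (f p) (f q).
Proof. by rewrite /sized_poly rmorph_digit_poly rmorph_pnorm !rmorphE. Qed.

Lemma rmorph_binomial_poly y n s x w k l m i j t p q :
  f (binomial_poly y n s x w k l m i j t p q) =
  binomial_poly (f y) (f n) (f s) (f x) (f w) (f k) (f l) (f m) (f i) (f j)
    (f t) (f p) (f q).
Proof. by rewrite /binomial_poly rmorph_sized_poly !rmorphE. Qed.

End Morphism.

(** * Zeros of the polynomial over the integers *)

Lemma add_sqr_eq0 (x y : int) : x ^+ 2 + y ^+ 2 = 0 <-> x = 0 /\ y = 0.
Proof.
split=> [/eqP | [-> ->] //]; rewrite paddr_eq0 ?sqr_ge0 // !sqrf_eq0.
by case/andP=> /eqP -> /eqP ->.
Qed.

Lemma value_poly_eq0 (P a b g C L N u y t : int) (n i j : nat) :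
  1 < a -> 1 < b -> 1 < g -> 0 < C -> 0 < P ->
  (exists p q : nat, value_poly P a b g C L N u y n%:Z i%:Z j%:Z t p%:Z q%:Z
    = 0)
  <-> [/\ is_square (pnorm b L), is_square (P * step_prod a n.+1%:Z C i%:Z
    j%:Z),
          is_square (pnorm g N) & 0 < quotient_gap y (y + t * u) C (L * N)].
Proof.
move=> a1 b1 g1 C0 P0; have nE : n%:Z + 1 = n.+1%:Z by lia.
have [_ _ _ _ aG] := stepG_facts i a1 C0.
have S0 : 0 < P * step_prod a n.+1%:Z C i%:Z j%:Z.
  by rewrite !mulr_gt0 ?pnorm_gt0 //; exact: lt_le_trans aG.
have [h1 h2] := two_squares (pnorm_gt0 L b1) S0.
have [h3 h4] := square_and_pos (quotient_gap y (y
  + t * u) C (L * N)) (pnorm_gt0 N g1).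
split=> [[p [q]] | [sL sP sN gap]].
  rewrite /value_poly nE add_sqr_eq0 => -[e1 e2].
  have [|sL sP] := h2; first by exists p; apply/eqP; rewrite -subr_eq0;
    apply/eqP.
  have [|sN gap] := h4; first by exists q; apply/eqP; rewrite -subr_eq0;
    apply/eqP.
  by [].
have [p e1] := h1 (conj sL sP); have [q e2] := h3 (conj sN gap).
exists p, q; rewrite /value_poly nE add_sqr_eq0 /pair_poly /pos_poly.
by rewrite e1 e2 !subrr.
Qed.

Lemma quotient_gap_gt0 (y T C Q : int) : 0 <= y -> 0 < Q ->
  0 < quotient_gap y T C Q <-> [/\ 0 < y, T * Q < C & C < (T + 1) * Q].
Proof.
move=> y0 Q0; rewrite /quotient_gap.
have -> : Q ^+ 2 - (2 * C - (2 * T + 1) * Q) ^+ 2 =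
  4 * (((T + 1) * Q - C) * (C - T * Q)) by ring.
(* The two factors have sum Q > 0, so a positive product makes both positive. *)
have s : ((T + 1) * Q - C) + (C - T * Q) = Q by ring.
rewrite -(subr_gt0 (T * Q)) -(subr_gt0 C).
move: ((T + 1) * Q - C) (C - T * Q) s => d e s; split=> [h | [yp e0 d0]].
  have yp : 0 < y by rewrite lt0r y0 andbT; apply/eqP => yz; move: h;
    rewrite yz mul0r ltxx.
  move: h; rewrite pmulr_rgt0 // pmulr_rgt0 // => h; split=> //;
    clear - h s Q0; nia.
by rewrite !mulr_gt0.
Qed.

Lemma scale_bounds (u v n : nat) : (0 < n)%N -> (2 ^ n < u)%N ->
  ((2 * u.+1) ^ n < v)%N -> (2 * u + 2 < v)%N /\ (n + 1 < u)%N.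
Proof.
move=> n0 hu hv; split; last first.
  by apply: leq_trans hu; rewrite addn1 ltnS ltn_expl.
by apply: leq_ltn_trans hv; case: n n0 {hu} => // n _; rewrite expnS; nia.
Qed.

Section Scale.
Variables (u v n : nat).
Hypotheses (n0 : (0 < n)%N) (hu : (2 ^ n < u)%N) (hv : ((2 * u.+1) ^ n < v)%N).
Let a : int := v%:Z * (u%:Z + 1) + 1.
Let b : int := v%:Z * u%:Z + 1.
Let g : int := v%:Z + 1.

(** No step-down is needed here: z <= Y_a(n + 1) <= (2 a)^n <= (v^2)^n, the last because 2 u + 2 <
    v, and this bounds the index in base c. *)
Lemma weak_index (c z : int) (r : nat) : v%:Z + 1 <= c -> 0 <= z ->
  (r <= n.+1)%N -> (c - 1 %| z - r%:Z)%Z -> is_square (pnorm c z) ->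
  z <= pellY a n.+1 -> z = pellY c r.
Proof.
move=> vc z0 rn cz sz za; have [v2 u2] := scale_bounds n0 hu hv.
have c1 : 1 < c by clear - vc v2; lia.
have a1 : 1 < a by rewrite /a; clear - v2; nia.
have [k zk] := pnorm_square c1 z0 sz.
rewrite zk; congr pellY; apply: (@pellY_index c) => //.
- clear - vc rn u2 v2; lia.
- by rewrite -zk.
rewrite -zk; apply: (@pell_index_bound _ _ v n) => //.
- clear - v2; lia.
- clear - v2 u2; lia.
apply: le_trans za _; apply: le_trans (pellY_ub n a1) _.
rewrite lerXn2r ?nnegrE ?sqr_ge0 //.
rewrite /a; clear - v2; nia.
Qed.

Lemma binomial_sound (y s k l m i j t : nat) :
  (s <= n)%N -> (0 < s)%N -> (y < u)%N -> 
  let C : int := n.+1%:Z + k%:Z * (a - 1) in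
  let L : int := s.+1%:Z + l%:Z * (b - 1) in
  let N : int := (n - s).+1%:Z + m%:Z * (g - 1) in
  is_square (pnorm a C) -> is_square (stepF a C i%:Z) ->
  is_square (stepI a n.+1%:Z C i%:Z j%:Z) ->
  is_square (pnorm b L) -> is_square (pnorm g N) ->
  0 < quotient_gap y%:Z (y%:Z + t%:Z * u%:Z) C (L * N) -> y = 'C(n, s).
Proof.
move=> sn s0 yu C L N sD sF sI sL sN; have [v2 u2] := scale_bounds n0 hu hv.
have a2 : 2 < a by rewrite /a; clear - v2; nia.
have vb : v%:Z + 1 <= b by rewrite /b; clear - u2; nia.
have na : n.+1%:Z < a - 1 by rewrite /a; clear - u2 v2; nia.
have C0 : 0 < C by rewrite /C; clear - a2; nia.
have L0 : 0 < L by rewrite /L; clear - vb; nia.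
have N0 : 0 < N by rewrite /N /g; clear; nia.
have LN0 : 0 < L * N by exact: mulr_gt0.
rewrite quotient_gap_gt0 // => -[y0 h1 h2].
(* With T >= 1 the quotient condition gives L N <= C, hence L <= C and N <= C. *)
have T1 : 1 <= y%:Z + t%:Z * u%:Z by clear - y0; nia.
have LNC : L * N <= C.
  by apply: le_trans (ltW h1); rewrite ler_peMl // ltW.
have LC : L <= C by apply: le_trans LNC; rewrite ler_peMr // ltW.
have NC : N <= C by apply: le_trans LNC; rewrite ler_peMl // ltW.
have CE : C = pellY a n.+1.
  by apply: step_down_index sD sF sI => //; rewrite /C addrC addKr dvdz_mull.
have LE : L = pellY b s.+1.
  apply: (weak_index vb (ltW L0)) => //; last by rewrite -CE.
  by rewrite /L addrC addKr dvdz_mull.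
have NE : N = pellY g (n - s).+1.
  apply: (weak_index (lexx _) (ltW N0)) => //; last by rewrite -CE.
    by rewrite ltnS leq_subr.
  by rewrite /N addrC addKr dvdz_mull.
have u1 : (1 < u)%N by clear - u2; lia.
have [h3 h4] := @pell_quotient a b g u v n s u1 s0 sn hv erefl erefl erefl.
move: h3 h4; rewrite -CE -LE -NE => h3 h4.
(* C / (L N) lies strictly between T and T + 1 for both candidates T, so these integers agree, and y
   < u is the residue modulo u. *)
have h5 := lt_trans h1 h4; have h6 := lt_trans h3 h2.
move: h5 h6; rewrite !ltr_pM2r // => h5 h6.
rewrite -(binomial_digit hu sn).
have -> : ((u.+1 ^ n) %/ u ^ s = t * u + y)%N by clear - h5 h6; lia.
by rewrite modnMDl modn_small.
Qed.

Lemma binomial_complete (s : nat) :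
  (s <= n)%N -> (0 < s)%N -> 
  exists k l m i j t : nat,
  let C : int := n.+1%:Z + k%:Z * (a - 1) in
  let L : int := s.+1%:Z + l%:Z * (b - 1) in
  let N : int := (n - s).+1%:Z + m%:Z * (g - 1) in
  [/\ is_square (pnorm a C), is_square (stepF a C i%:Z),
   is_square (stepI a n.+1%:Z C i%:Z j%:Z) &
  [/\ is_square (pnorm b L), is_square (pnorm g N) &
  0 < quotient_gap 'C(n, s)%:Z ('C(n, s)%:Z + t%:Z * u%:Z) C (L * N)]].
Proof.
move=> sn s0; have [v2 u2] := scale_bounds n0 hu hv.
have a1 : 1 < a by rewrite /a; clear - v2; nia.
have b1 : 1 < b by rewrite /b; clear - u2 v2; nia.
have g1 : 1 < g by rewrite /g; clear - v2; lia.
have quot (c : int) (r : nat) : 1 < c ->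
    exists k : nat, r%:Z + k%:Z * (c - 1) = pellY c r.
  move=> c1; have /dvdzP[k ek] := pellY_id_dvd c r.
  have := pellY_geid r c1 => le.
  exists `|k|%N; rewrite gez0_abs; first by rewrite -ek; ring.
  by clear - ek le c1; nia.
have [k ek] := quot a n.+1 a1; have [l el] := quot b s.+1 b1.
have [m em] := quot g (n - s).+1 g1.
have [i [j [sF sI]]] := step_up a1 (n0 : (1 < n.+1)%N).
(* t collects the digits above the binomial coefficient: the integer part is t u + 'C(n, s). *)
exists k, l, m, i, j, ((u.+1 ^ n) %/ u ^ s %/ u)%N => /=.
rewrite ek el em !pnorm_pell; split=> //; first by exists (pellX a n.+1).
split; [by exists (pellX b s.+1) | by exists (pellX g (n - s).+1) |].
have u1 : (1 < u)%N by clear - u2; lia.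
have pos (c : int) r : 1 < c -> 0 < pellY c r.+1.
  by move=> c1; have := pellY_geid r.+1 c1; clear; lia.
rewrite quotient_gap_gt0 ?mulr_gt0 ?pos //.
have -> : 'C(n, s)%:Z + ((u.+1 ^ n) %/ u ^ s %/ u)%N%:Z * u%:Z =
    ((u.+1 ^ n) %/ u ^ s)%N%:Z.
  by rewrite -(binomial_digit hu sn) addrC {3}(divn_eq (_ %/ u ^ s) u).
have [h3 h4] := @pell_quotient a b g u v n s u1 s0 sn hv erefl erefl erefl.
by split=> //; rewrite ltz_nat bin_gt0.
Qed.
End Scale.

Lemma large_scales (n u w : nat) (P1 P2 : int) :
  (0 < n)%N -> (0 < u)%N ->
  P1 = pnorm (n%:Z + 3) ((n%:Z + 2) * u%:Z) ->
  P2 = pnorm (P1 + 1) (P1 * (w%:Z + 1)) ->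
  is_square P1 -> is_square P2 ->
  (2 ^ n < u)%N /\ ((2 * u.+1) ^ n)%N%:Z < P1 * P2 * (w%:Z + 1).
Proof.
move=> n0 u0 e1 e2 s1 s2.
(* Both 2 u + 2 <= P1 and n <= P1 - 2 follow from this bound. *)
have P1_ge : 4 * u%:Z ^+ 2 + n%:Z < P1.
  have a1 : 1 < n%:Z + 3 :> int by lia.
  have := pnorm_ge ((n%:Z + 2) * u%:Z) a1; rewrite -e1; apply: le_lt_trans.
  by clear - n0 u0; rewrite expr2; nia.
have P1_gt : 2 * u%:Z + 2 <= P1 by clear - P1_ge u0; nia.
have P2_gt0 : 0 < P2 by rewrite e2 pnorm_gt0 //; clear - P1_gt; lia.
split.
  rewrite e1 in s1; have := pell_large (u0 : 0 < u%:Z) s1.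
  rewrite -ltz_nat; apply: lt_le_trans; rewrite PoszX ltrXn2r ?nnegrE //; lia.
(* With k = P1 - 2 the base k + 3 is P1 + 1, so w + 1 >= (P1 + 1)^k >= (2 u + 2)^n. *)
pose k := `|P1 - 2|%N; have ek : k%:Z = P1 - 2 by clear - P1_gt; lia.
have w0 : 0 < w%:Z + 1 :> int by lia.
have [h3 h2] : P1 + 1 = k%:Z + 3 /\ P1 = k%:Z + 2 by rewrite ek; split; ring.
have := @pell_large k (w%:Z + 1) w0.
rewrite -h3 -h2 -e2 => /(_ s2) h.
apply: (@le_lt_trans _ _ (w%:Z + 1)).
  apply: le_trans h; rewrite PoszX; apply: (@le_trans _ _ ((P1 + 1) ^+ n)).
    by rewrite lerXn2r ?nnegrE //; clear - P1_gt; lia.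
  have nk : (n <= k)%N by clear - ek P1_ge u0; nia.
  by apply: ler_weXn2l => //; clear - P1_gt; lia.
have PP : 1 < P1 * P2 by clear - P1_gt P2_gt0; nia.
by rewrite ltr_pMl.
Qed.

Lemma scale_poly_eq0 (P : int) (u v y n s k l m i j t : nat) :
  (s <= n)%N -> (0 < u)%N -> (0 < v)%N -> 0 < P -> (P %| v%:Z)%Z ->
  let a : int := v%:Z * (u%:Z + 1) + 1 in
  let b : int := v%:Z * u%:Z + 1 in
  let g : int := v%:Z + 1 in
  let C : int := n.+1%:Z + k%:Z * (a - 1) in
  let L : int := s.+1%:Z + l%:Z * (b - 1) in
  let N : int := (n - s).+1%:Z + m%:Z * (g - 1) in
  (exists p q : nat, scale_poly P v%:Z u%:Z y%:Z n%:Z s%:Z k%:Z l%:Z m%:Z i%:Z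
     j%:Z t%:Z p%:Z q%:Z = 0) <->
  is_square P /\
  [/\ is_square (pnorm a C), is_square (stepF a C i%:Z),
      is_square (stepI a n.+1%:Z C i%:Z j%:Z) &
  [/\ is_square (pnorm b L), is_square (pnorm g N) &
      0 < quotient_gap y%:Z (y%:Z + t%:Z * u%:Z) C (L * N)]].
Proof.
move=> sn u0 v0 P0 Pv a b g C L N.
have a1 : 1 < a by rewrite /a; clear - v0; nia.
have b1 : 1 < b by rewrite /b; clear - v0 u0; nia.
have g1 : 1 < g by rewrite /g; clear - v0; lia.
have C0 : 0 < C by rewrite /C; clear - a1; nia.
have Pa : (P %| a - 1)%Z by rewrite /a addrK dvdz_mulr.
have [s1 s2] := @step_prod_square a C P n.+1 i j a1 C0 P0 Pa.
have [h1 h2] := value_poly_eq0 L N u%:Z y%:Z t%:Z n i j a1 b1 g1 C0 P0.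
rewrite /scale_poly /base_poly.
have -> : n%:Z + 1 = n.+1%:Z by clear; lia.
have -> : s%:Z + 1 = s.+1%:Z by clear; lia.
(* Integer and truncated subtraction agree because s <= n. *)
have -> : n%:Z - s%:Z + 1 = (n - s).+1%:Z by clear - sn; lia.
split; first by case/h1 => sL /s1[sP [sD sF sI]] sN gap.
by case=> sP [sD sF sI [sL sN gap]]; apply: h2; split=> //; apply: s2.
Qed.

Lemma binomial_poly_eq0 (y n s : nat) : (s <= n)%N -> (0 < s)%N ->
  y = 'C(n, s) <->
  exists x w k l m i j t p q : nat,
    binomial_poly y%:Z n%:Z s%:Z x%:Z w%:Z k%:Z l%:Z m%:Z i%:Z j%:Z t%:Z
      p%:Z q%:Z = 0.
Proof.
move=> sn s0; have n0 : (0 < n)%N by exact: leq_trans sn.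
have scales (u w : nat) (P1 P2 : int) : (0 < u)%N ->
    P1 = pnorm (n%:Z + 3) ((n%:Z + 2) * u%:Z) ->
    P2 = pnorm (P1 + 1) (P1 * (w%:Z + 1)) ->
    [/\ 0 < P1, 0 < P2, coprimez P1 P2 &
     exists2 v : nat, (0 < v)%N & v%:Z = P1 * P2 * (w%:Z + 1)].
  move=> u0 e1 e2.
  have P10 : 0 < P1 by rewrite e1 pnorm_gt0 //; clear; lia.
  have P20 : 0 < P2 by rewrite e2 pnorm_gt0 //; clear - P10; lia.
  have V0 : 0 < P1 * P2 * (w%:Z + 1) by rewrite !mulr_gt0 //; clear; lia.
  split=> //; first by apply: coprimez_congr1; rewrite e2 pnorm_congr1 // addrK.
  by exists (absz (P1 * P2 * (w%:Z + 1))); clear - V0; lia.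
split; last first.
  case=> x [w [k [l [m [i [j [t [p [q]]]]]]]]].
  rewrite /binomial_poly -[y%:Z + 1 + x%:Z]/((y + 1 + x)%N%:Z).
  have : (y < y + 1 + x)%N by clear; lia.
  move: (y + 1 + x)%N => u yu; have u0 : (0 < u)%N by exact: leq_ltn_trans yu.
  rewrite /sized_poly; move e1: (pnorm (n%:Z + 3) _) => P1.
  rewrite /digit_poly; move e2: (pnorm (P1 + 1) _) => P2.
  have [P10 P20 cop [v v0 ev]] := scales u w P1 P2 u0 (esym e1) (esym e2).
  have P0 : 0 < P1 * P2 by exact: mulr_gt0.
  rewrite /size_poly -ev => h.
  have Pv : (P1 * P2 %| v%:Z)%Z by rewrite ev dvdz_mulr.
  have [h1 _] := @scale_poly_eq0 (P1 * P2) u v y n s k l m i j t sn u0 v0 P0 Pv.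
  have [|sP [sD sF sI [sL sN gap]]] := h1; first by exists p, q.
  have /(square_mul P10 P20 cop)[s1 s2] := sP.
  have [hu] := large_scales n0 u0 (esym e1) (esym e2) s1 s2.
  rewrite -ev ltz_nat => hv.
  exact: binomial_sound sD sF sI sL sN gap.
(* Any admissible u > y will do; x is then u - y - 1. *)
move=> yE; have [u yu s1] := pell_unbounded n y.
have u0 : (0 < u)%N by exact: leq_ltn_trans yu.
have [P1 e1] : exists P1, P1 = pnorm (n%:Z + 3) ((n%:Z + 2) * u%:Z) by eexists.
have P1_gt : 1 < P1.
  have a1 : 1 < n%:Z + 3 :> int by clear; lia.
  by have := pnorm_ge ((n%:Z + 2) * u%:Z) a1; rewrite -e1; clear - u0; nia.
(* M stands for w + 1, so M > 0 suffices and w is [M.-1]. *)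
have [M M0 s2] := pell_unbounded `|P1 - 2|%N 0.
have [P2 e2] : exists P2, P2 = pnorm (P1 + 1) (P1 * (M.-1%:Z + 1)) by eexists.
have {}s2 : is_square P2.
  have ek : `|P1 - 2|%N%:Z = P1 - 2 by clear - P1_gt; lia.
  move: s2; rewrite ek e2.
  have -> : P1 - 2 + 3 = P1 + 1 by ring.
  have -> : P1 - 2 + 2 = P1 by ring.
  by have -> : M.-1%:Z + 1 = M%:Z by clear - M0; lia.
rewrite -e1 in s1.
have [P10 P20 cop [v v0 ev]] := scales u M.-1 P1 P2 u0 e1 e2.
have P0 : 0 < P1 * P2 by exact: mulr_gt0.
have Pv : (P1 * P2 %| v%:Z)%Z by rewrite ev dvdz_mulr.
have [hu] := large_scales n0 u0 e1 e2 s1 s2.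
rewrite -ev ltz_nat => hv.
have [k [l [m [i [j [t [sD sF sI sLN]]]]]]] := binomial_complete n0 hu hv sn s0.
rewrite -yE in sLN.
have [_ h2] := @scale_poly_eq0 (P1 * P2) u v y n s k l m i j t sn u0 v0 P0 Pv.
have [|p [q h]] := h2; first by split; [apply/(square_mul P10 P20 cop) | ].
exists (u - y.+1)%N, M.-1, k, l, m, i, j, t, p, q.
rewrite /binomial_poly.
have -> : y%:Z + 1 + (u - y.+1)%N%:Z = u%:Z by clear - yu; lia.
by rewrite /sized_poly -e1 /digit_poly -e2 /size_poly -ev.
Qed.

Local Close Scope ring_scope.

Theorem theorem7 :
  exists F : {mpoly int[13]},
    forall y n s : nat, s <= n -> 0 < s ->
      (y = 'C(n, s) <->
       exists x w k l m i j v1 v2 v3 : nat,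
         (F.@[tnth [tuple y%:Z; n%:Z; s%:Z; x%:Z; w%:Z; k%:Z; l%:Z; m%:Z;
                          i%:Z; j%:Z; v1%:Z; v2%:Z; v3%:Z]] = 0)%R).
Proof.
pose X h (lt : h < 13) : {mpoly int[13]} := ('X_(Ordinal lt))%R.
pose F := binomial_poly (X 0 isT) (X 1 isT) (X 2 isT) (X 3 isT) (X 4 isT)
  (X 5 isT) (X 6 isT) (X 7 isT) (X 8 isT) (X 9 isT) (X 10 isT) (X 11 isT)
  (X 12 isT).
exists F => y n s sn s0; rewrite (binomial_poly_eq0 y sn s0).
(* Evaluation is a ring morphism, so it passes through the stages without expanding the
   polynomial. *)
have eval x w k l m i j t p q :
    (F.@[tnth [tuple y%:Z; n%:Z; s%:Z; x; w; k; l; m; i; j; t; p; q]]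
     = binomial_poly y%:Z n%:Z s%:Z x w k l m i j t p q)%R.
  by rewrite rmorph_binomial_poly /X /= !mevalXU.
by split=> -[x [w [k [l [m [i [j [t [p [q h]]]]]]]]]];
  exists x, w, k, l, m, i, j, t, p, q; move: h; rewrite eval.
Qed.
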